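(* Let $M\ge2$, let $\rho_1,\dots,\rho_M$ be density matrices with a priori probabilities $p_1,\dots,p_M>0$, $\sum_jp_j=1$, on the Hilbert space $\mathcal H=\sum_{j}\mathcal S_{\rho_j}$ spanned by their supports. Fix $i\in\{1,\dots,M\}$ and put $$\tilde\rho_1=\rho_i,\qquad \tilde\rho_2=\frac{1}{1-p_i}\sum_{j\ne i}p_j\rho_j .$$ For a subspace $\mathcal X\subset\mathcal H$ with orthogonal complement $\mathcal X^\perp$ in $\mathcal H$, such that $N_j:=\mathrm{Tr}(\rho_j\Pi_{\mathcal X^\perp})>0$ for all $j$, let the problem reduced by $\mathcal X$ be the one on $\mathcal X^\perp$ with $$\rho_j'=\frac1{N_j}\Pi_{\mathcal X^\perp}\rho_j\Pi_{\mathcal X^\perp},\qquad p_j'=\frac{N_jp_j}{\sum_{k}N_kp_k}\qquad(j=1,\dots,M),$$ where $\Pi$ denotes orthogonal projection. (a) (Common subspace.) Let $\mathcal X=\mathcal S_{\tilde\rho_1}\cap\mathcal S_{\tilde\rho_2}$ and suppose $N_j>0$ for all $j$. Then $\mathcal X$ can be split off from the problem: $\{F_?,F_1,\dots,F_M\}$ is an optimal unambiguous state discrimination measurement for $(\rho_j;p_j)_j$ on $\mathcal H$ if and only if $F_j=F_j'$ for $j=1,\dots,M$ and $F_?=F_?'+\Pi_{\mathcal X}$, where $\{F_?',F_1',\dots,F_M'\}$ (extended by $0$ on $\mathcal X$) is an optimal unambiguous state discrimination measurement for the problem reduced by $\mathcal X$. (b) (Orthogonal subspace.) Let $\mathcal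 X=\mathcal S_{\tilde\rho_2}^\perp\cap\mathcal S_{\tilde\rho_1}$ and suppose $N_j>0$ for all $j$. Then $\mathcal X$ can be eliminated from the problem: if $\{F_?',F_1',\dots,F_M'\}$ (extended by $0$ on $\mathcal X$) is an optimal unambiguous state discrimination measurement for the problem reduced by $\mathcal X$, then $F_i=F_i'+\Pi_{\mathcal X}$, $F_j=F_j'$ for $j\neq i$, $F_?=F_?'$ define an optimal unambiguous state discrimination measurement for $(\rho_j;p_j)_j$ on $\mathcal H$.
   Context: All Hilbert spaces are finite-dimensional and complex. A density matrix is a positive semi-definite Hermitian operator of trace $1$. The support $\mathcal S_P$ of a positive semi-definite Hermitian operator $P$ is the span of its eigenvectors with non-zero eigenvalues. Orthogonal complements are taken in $\mathcal H$. A POVM on a Hilbert space $\mathcal H$ is a family $\{F_k\}$ of positive semi-definite Hermitian operators on $\mathcal H$ with $\sum_kF_k=\mathbb 1_{\mathcal H}$. An unambiguous state discrimination measurement (USDM) on $\mathcal H$ for density matrices $\rho_1,\dots,\rho_M$ is a POVM $\{F_?,F_1,\dots,F_M\}$ on $\mathcal H$ with $\mathrm{Tr}(\rho_jF_k)=0$ for all $j\ne k$ in $\{1,\dots,M\}$. Given a priori probabilities $p_j$, its failure probability is $Q[\{F_k\}]=\sum_jp_j\mathrm{Tr}(\rho_jF_?)$. A USDM is optimal if its failure probability is minimal among all USDMs for $\rho_1,\dots,\rho_M$ on $\mathcal H$. *)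

(* Defs.v *)
From mathcomp Require Import all_boot all_order all_algebra.
From mathcomp Require Import reals complex.

Set Implicit Arguments.
Unset Strict Implicit.
Unset Printing Implicit Defensive.

Import Order.TTheory GRing.Theory Num.Theory.
Local Open Scope ring_scope.

(* Hilbert spaces are the spaces 'rV[C]_n with the inner product dotmx and
   their subspaces.  An operator is a matrix A acting on row vectors by
   u |-> u *m A, and a subspace is the row space of a matrix, so that
   eigenvectors, ranges and supports all live in row spaces.
   The order of C is the partial one: 0 <= z means that z is real and
   nonnegative. *)

Notation "X ^!" :=
  (orthomx Num.conj (mx_of_hermitian (hermitian1mx _)) X) : matrix_set_scope.

Section Discrimination.
Variables (C : numClosedFieldType) (n : nat).
Implicit Types (A X Y : 'M[C]_n).

Definition psdmx A : Prop :=
  A \is hermsymmx /\ forall u : 'rV[C]_n, 0 <= dotmx (u *m A) u.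

Definition density_mx A : Prop := psdmx A /\ \tr A = 1.

Definition eigenvalues A : seq C := sval (closed_field_poly_normal (char_poly A)).

Definition support_mx A : 'M[C]_n :=
  (\sum_(a <- eigenvalues A | a != 0) eigenspace A a)%MS.

Lemma mem_eigenvalues A a : (a \in eigenvalues A) = eigenvalue A a.
Proof.
rewrite eigenvalue_root_char /eigenvalues; case: closed_field_poly_normal => r /= {1}->.
by rewrite (monicP (char_poly_monic A)) scale1r root_prod_XsubC.
Qed.

Lemma support_mxP A Y :
  (support_mx A <= Y)%MS <->
  (forall (a : C) (u : 'rV[C]_n), a != 0 -> u *m A = a *: u -> (u <= Y)%MS).
Proof.
split=> [sAY a u a0 uA | H].
  have [->|u0] := eqVneq u 0; first exact: sub0mx.
  apply: submx_trans sAY; rewrite /support_mx.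
  have ar : a \in eigenvalues A.
    by rewrite mem_eigenvalues; apply/eigenvalueP; exists u.
  rewrite (big_rem a) //= a0.
  by apply: submx_trans (addsmxSl _ _); apply/eigenspaceP.
rewrite /support_mx; elim/big_ind: _ => [|B B' sB sB'|a a0]; first exact: sub0mx.
  by rewrite addsmx_sub sB.
by apply/rV_subP => u /eigenspaceP; apply: H.
Qed.

(* A is an operator on Y, extended by 0 on the orthogonal complement of Y. *)
Definition operator_on Y A : Prop := (A <= Y)%MS /\ (Y^!)%MS *m A = 0.

(* A POVM on Y; the identity of Y extended by 0 is the projection onto Y. *)
Definition povm (K : finType) Y (F : K -> 'M[C]_n) : Prop :=
  (forall k, operator_on Y (F k) /\ psdmx (F k)) /\ \sum_k F k = proj_ortho Y.

Variable M : nat.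
Implicit Types (rho : 'I_M -> 'M[C]_n) (p : 'I_M -> C).
Implicit Types (F : option 'I_M -> 'M[C]_n).

(* F None is the operator of the inconclusive outcome "?". *)
Definition usdm Y rho F : Prop :=
  povm Y F /\ forall j k : 'I_M, j != k -> \tr (rho j *m F (Some k)) = 0.

Definition failure rho p F : C := \sum_j p j * \tr (rho j *m F None).

Definition optimal_usdm Y rho p F : Prop :=
  usdm Y rho F /\ forall G, usdm Y rho G -> failure rho p F <= failure rho p G.

Definition rest_state rho p (i : 'I_M) : 'M[C]_n :=
  (1 - p i)^-1 *: \sum_(j | j != i) p j *: rho j.

Definition reduced_weight X rho (j : 'I_M) : C :=
  \tr (rho j *m proj_ortho (X^!)%MS).

Definition reduced_state X rho (j : 'I_M) : 'M[C]_n :=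
  (reduced_weight X rho j)^-1 *:
    (proj_ortho (X^!)%MS *m rho j *m proj_ortho (X^!)%MS).

Definition reduced_prior X rho p (j : 'I_M) : C :=
  reduced_weight X rho j * p j / \sum_k reduced_weight X rho k * p k.

Definition reduced_optimal_usdm X rho p F : Prop :=
  optimal_usdm (X^!)%MS (reduced_state X rho) (reduced_prior X rho p) F.

End Discrimination.

(* Main.v *)
Require Import Defs.
From mathcomp Require Import all_boot all_order all_algebra.
From mathcomp Require Import reals complex.

(* For positive A and B, Tr(AB) = 0 forces AB = 0, so the conclusive operators
   F_k of a USDM kill the supports of the states rho_j, j <> k.  In (a) all of
   them therefore kill X, whence F_? is the identity on X: every USDM is the
   direct sum of Pi_X and a USDM of the reduced problem, and the failure
   probabilities of the two are related by an increasing affine map.  In (b)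
   only the F_k with k <> i kill X, and F_i may mix X with its complement.  The
   idea is to replace F_? by S, its Schur complement with respect to X, and F_i
   by F_i + (F_? - S).  As S <= F_?, the failure probability does not increase;
   as S kills X, the new F_i is the identity on X, so that Pi_X splits off; and
   as F_? maps the supports of the rho_j, j <> i, into the complement of X, the
   difference F_? - S kills these supports and the discrimination stays
   unambiguous. *)

Set Implicit Arguments.
Unset Strict Implicit.
Unset Printing Implicit Defensive.

Import Order.TTheory GRing.Theory Num.Theory.
Local Open Scope ring_scope.
Local Open Scope sesquilinear_scope.

Lemma big_option (V : nmodType) (T : finType) (A : option T -> V) :
  \sum_k A k = A None + \sum_x A (Some x).
Proof.
rewrite (bigD1 None) //=; congr (_ + _).
rewrite (reindex_omap Some id) => [|[]//].
by apply: eq_bigl => x; rewrite /= eqxx.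
Qed.

(** * Positive semi-definite matrices, their factorisations and traces of their products *)

Section PositiveMatrices.
Variable C : numClosedFieldType.

Lemma adjmxM m n p (A : 'M[C]_(m, n)) (B : 'M_(n, p)) :
  (A *m B)^t* = B^t* *m A^t*.
Proof. by rewrite trmx_mul map_mxM. Qed.

Lemma hermsymmxE n (A : 'M[C]_n) : (A \is hermsymmx) = (A^t* == A).
Proof. by rewrite is_hermitianmxE expr0 scale1r eq_sym. Qed.

Lemma hermsymmxP n (A : 'M[C]_n) : reflect (A^t* = A) (A \is hermsymmx).
Proof. by rewrite hermsymmxE; apply: eqP. Qed.

Lemma gram_diag m n (T : 'M[C]_(m, n)) i :
  (T *m T^t*) i i = \sum_k `|T i k| ^+ 2.
Proof. by rewrite mxE; apply: eq_bigr => k _; rewrite !mxE normCK. Qed.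

Lemma mxtrace_gram_ge0 m n (T : 'M[C]_(m, n)) : 0 <= \tr (T *m T^t*).
Proof.
apply: sumr_ge0 => i _; rewrite gram_diag; apply: sumr_ge0 => k _.
exact: exprn_ge0.
Qed.

Lemma mxtrace_gram_eq0 m n (T : 'M[C]_(m, n)) : \tr (T *m T^t*) = 0 -> T = 0.
Proof.
move=> /eqP; rewrite psumr_eq0 => [/allP T0|i _]; last first.
  by rewrite gram_diag; apply: sumr_ge0 => k _; exact: exprn_ge0.
apply/matrixP => i j; rewrite mxE; apply/eqP.
have := T0 i (mem_index_enum i); rewrite gram_diag psumr_eq0; last first.
  by move=> k _; exact: exprn_ge0.
move=> /allP Ti0.
by have := Ti0 j (mem_index_enum j); rewrite sqrf_eq0 normr_eq0.
Qed.

Lemma psdmx_adj n (A : 'M[C]_n) : psdmx A -> A^t* = A.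
Proof. by case=> /hermsymmxP. Qed.

Lemma psdmx_gram m n (T : 'M[C]_(m, n)) : psdmx (T *m T^t*).
Proof.
split=> [|u]; first by apply/hermsymmxP; rewrite adjmxM trmxCK.
by rewrite dotmxE -trace_mx11 -!mulmxA mulmxA -adjmxM mxtrace_gram_ge0.
Qed.

Lemma psdmx_sqrt n (A : 'M[C]_n) : psdmx A -> exists T : 'M_n, A = T *m T^t*.
Proof.
move=> [hA pA]; have /orthomx_spectralP := hermitian_normalmx hA.
have := spectral_unitarymx A.
move: (spectralmx A) (spectral_diag A) => U d uU; rewrite invmx_unitary // => eA.
(* Each [d 0 i] is the value of the quadratic form of [A] at row [i] of [U]. *)
have d_ge0 i : 0 <= d 0 i.
  have Ud : U *m A *m U^t* = diag_mx d.
    by rewrite eA !mulmxA (unitarymxP uU) mul1mx mulmxtVK.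
  have := pA (row i U); rewrite dotmxE -row_mul tr_row map_col.
  by rewrite colE mulmxA -row_mul Ud -colE !mxE eqxx mulr1n.
exists (U^t* *m diag_mx (map_mx sqrtC d)).
rewrite adjmxM trmxCK tr_diag_mx map_diag_mx -map_mx_comp mulmxA.
rewrite -[_ *m diag_mx _ *m diag_mx _]mulmxA mulmx_diag {1}eA.
congr (_ *m diag_mx _ *m _).
apply/rowP => i; rewrite !mxE /= geC0_conj ?sqrtC_ge0 //.
by rewrite -expr2 sqrtCK.
Qed.

Lemma psdmx_conj m n (A : 'M[C]_n) (B : 'M_(m, n)) :
  psdmx A -> psdmx (B *m A *m B^t*).
Proof.
by case/psdmx_sqrt=> T ->; rewrite -!mulmxA mulmxA -adjmxM; apply: psdmx_gram.
Qed.

Lemma psdmxD n (A B : 'M[C]_n) : psdmx A -> psdmx B -> psdmx (A + B).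
Proof.
move=> [/hermsymmxP hA pA] [/hermsymmxP hB pB]; split=> [|u].
  by apply/hermsymmxP; rewrite linearD map_mxD hA hB.
by rewrite dotmxE mulmxDr mulmxDl mxE -!dotmxE addr_ge0.
Qed.

Lemma psdmxZ n a (A : 'M[C]_n) : 0 <= a -> psdmx A -> psdmx (a *: A).
Proof.
move=> a0 [/hermsymmxP hA pA]; split=> [|u].
  by apply/hermsymmxP; rewrite linearZ map_mxZ hA /= geC0_conj.
by rewrite dotmxE -scalemxAr -scalemxAl mxE -dotmxE mulr_ge0.
Qed.

Lemma psdmx0 n : psdmx (0 : 'M[C]_n).
Proof. by have := psdmx_gram (0 : 'M[C]_n); rewrite mul0mx. Qed.

Lemma psdmx_sum n (I : finType) (P : pred I) (A : I -> 'M[C]_n) :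
  (forall i, P i -> psdmx (A i)) -> psdmx (\sum_(i | P i) A i).
Proof. by move=> pA; elim/big_ind: _ => //; [exact: psdmx0 | exact: psdmxD]. Qed.

(** By cyclicity, the trace of a product of two positive matrices is a squared Hilbert-Schmidt norm,
    hence nonnegative, and zero only if [T^t* *m U] is. *)
Lemma mxtrace_gramM m n p (T : 'M[C]_(n, m)) (U : 'M[C]_(n, p)) :
  \tr ((T *m T^t*) *m (U *m U^t*)) = \tr ((T^t* *m U) *m (T^t* *m U)^t*).
Proof. by rewrite adjmxM trmxCK mxtrace_mulC !mulmxA mxtrace_mulC !mulmxA. Qed.

(** The traces of [X *m A i *m X^t*] are nonnegative and add up to 0, so each vanishes; with
    [A i = T *m T^t*] this gives [X *m T = 0]. *)
Lemma psdmx_sum_mul0 m n (I : finType) (P : pred I) (A : I -> 'M[C]_n)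
    (X : 'M_(m, n)) :
  (forall i, P i -> psdmx (A i)) -> X *m (\sum_(i | P i) A i) = 0 ->
  forall i, P i -> X *m A i = 0.
Proof.
move=> pA XA i Pi.
have t_ge0 k : P k -> 0 <= \tr (X *m A k *m X^t*).
  case/pA/psdmx_sqrt=> T ->.
  by rewrite mulmxA -[_ *m T^t* *m _]mulmxA -adjmxM mxtrace_gram_ge0.
have /eqP : \sum_(k | P k) \tr (X *m A k *m X^t*) = 0.
  by rewrite -raddf_sum -mulmx_suml -mulmx_sumr XA mul0mx /= mxtrace0.
rewrite psumr_eq0 // => /allP/(_ i (mem_index_enum i)); rewrite Pi /=.
have [T ->] := psdmx_sqrt (pA i Pi).
rewrite mulmxA -[_ *m T^t* *m _]mulmxA -adjmxM => /eqP/mxtrace_gram_eq0->.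
exact: mul0mx.
Qed.

Lemma mxtrace_psdmxM_ge0 n (A B : 'M[C]_n) :
  psdmx A -> psdmx B -> 0 <= \tr (A *m B).
Proof.
case/psdmx_sqrt=> T -> /psdmx_sqrt[U ->].
by rewrite mxtrace_gramM mxtrace_gram_ge0.
Qed.

Lemma mxtrace_psdmxM_eq0 n (A B : 'M[C]_n) :
  psdmx A -> psdmx B -> \tr (A *m B) = 0 -> A *m B = 0.
Proof.
case/psdmx_sqrt=> T -> /psdmx_sqrt[U ->].
rewrite mxtrace_gramM => /mxtrace_gram_eq0 TU.
by rewrite mulmxA -(mulmxA T) TU mulmx0 mul0mx.
Qed.

(** Lets supports be handled as row spaces. In the spectral form of [A], the rows of
    [diag_mx d *m U] span the row space and are zero or eigenvectors with nonzero eigenvalue. *)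
Lemma psdmx_support n (A : 'M[C]_n) : psdmx A -> (support_mx A :=: A)%MS.
Proof.
move=> [hA pA]; apply/eqmxP/andP; split.
  apply/support_mxP => a u a0 uA.
  by rewrite -[u](scalerK a0) -uA scalemx_sub ?submxMl.
have sA : (support_mx A <= support_mx A)%MS := submx_refl _.
have /support_mxP {}sA := sA.
have /orthomx_spectralP := hermitian_normalmx hA.
have := spectral_unit A.
move: (spectralmx A) (spectral_diag A) => U d uU eA.
have UA : U *m A = diag_mx d *m U by rewrite {1}eA !mulmxA mulmxV ?mul1mx.
rewrite {1}eA -mulmxA mulmx_sub //; apply/row_subP => i.
rewrite row_mul row_diag_mx -scalemxAl -rowE.
have [->|di0] := eqVneq (d 0 i) 0; first by rewrite scale0r sub0mx.
rewrite scalemx_sub // (sA (d 0 i)) //.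
by rewrite -row_mul UA row_mul row_diag_mx -scalemxAl -rowE.
Qed.

(** * Orthogonal projections and operators on a complement *)

Lemma proj_ortho1 n : proj_ortho 1%:M = 1%:M :> 'M[C]_n.
Proof. by rewrite -[LHS]mul1mx proj_ortho_id. Qed.

Lemma proj_ortho_add_compl n (X : 'M[C]_n) :
  proj_ortho X + proj_ortho (X^!)%MS = 1%:M.
Proof. by rewrite -[RHS](add_proj_ortho X) !mul1mx. Qed.

(** The ranges of [Q] and [1 - Q] are orthogonal, so [Q = Q *m Q^t*], which is self-adjoint. *)
Lemma proj_ortho_adj n (X : 'M[C]_n) : (proj_ortho X)^t* = proj_ortho X.
Proof.
set Q := proj_ortho X.
have QP : Q *m (1%:M - Q)^t* = 0.
  apply/orthomx1P; rewrite orthomx_sym (submx_trans (B := (X^!)%MS)) //.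
    by rewrite -[Q]mul1mx proj_ortho_compl_sub.
  by rewrite submx_ortho -[Q]mul1mx proj_ortho_sub.
have QE : Q = Q *m Q^t*.
  apply/eqP; rewrite -subr_eq0 -{1}[Q]mulmx1 -mulmxBr.
  by move: QP; rewrite linearB map_mxB /= trmx1 map_mx1 => ->.
by rewrite QE adjmxM trmxCK.
Qed.

Lemma psdmx_proj_ortho n (X : 'M[C]_n) : psdmx (proj_ortho X).
Proof.
by rewrite -[proj_ortho X]proj_ortho_proj -{2}proj_ortho_adj; apply: psdmx_gram.
Qed.

Lemma operator_on1 n (A : 'M[C]_n) : operator_on 1%:M A.
Proof.
split; first exact: submx1.
have /eqP-> : (1%:M^!)%MS == 0 :> 'M[C]_n.
  by rewrite -mxrank_eq0 rank_ortho mxrank1 subnn.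
exact: mul0mx.
Qed.

Lemma mul_proj_ortho_eq0 m n (X : 'M[C]_n) (A : 'M_(n, m)) :
  proj_ortho X *m A = 0 <-> X *m A = 0.
Proof.
have eX : X = X *m proj_ortho X by rewrite proj_ortho_id.
have /submxP[W eQ] : (proj_ortho X <= X)%MS by rewrite proj_orthoE.
split=> A0; first by rewrite eX -mulmxA A0 mulmx0.
by rewrite eQ -mulmxA A0 mulmx0.
Qed.

Lemma psdmx_mul_proj_ortho0 n (X A : 'M[C]_n) :
  psdmx A -> X *m A = 0 -> A *m proj_ortho X = 0.
Proof.
move=> pA /mul_proj_ortho_eq0 QA.
by rewrite -(psdmx_adj pA) -proj_ortho_adj -adjmxM QA trmx0 map_mx0.
Qed.

(** For Hermitian [A] the range and kernel conditions are adjoint to each other, and [X^!^!] has the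
    row space of [X], so one equation captures both. *)
Lemma operator_on_orthoP n (X A : 'M[C]_n) : A^t* = A ->
  operator_on (X^!)%MS A <-> X *m A = 0.
Proof.
move=> hA; split=> [[_ XA]|XA].
  have /submxP[W ->] : (X <= X^!^!)%MS by rewrite ortho_id.
  by rewrite -mulmxA XA mulmx0.
split; first by apply/orthomx1P; rewrite -hA -adjmxM XA trmx0 map_mx0.
have /submxP[W ->] : (X^!^! <= X)%MS by rewrite ortho_id.
by rewrite -mulmxA XA mulmx0.
Qed.

Lemma mulmx_sub_proj n (X A : 'M[C]_n) :
  X *m A = X -> X *m (A - proj_ortho X) = 0.
Proof. by move=> XA; rewrite mulmxBr XA proj_ortho_id // subrr. Qed.

(** As [A] is Hermitian, it acts as the identity on [X] from both sides, so the difference is the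
    compression of [A] by [B = 1 - proj_ortho X]. *)
Lemma psdmx_sub_proj n (X A : 'M[C]_n) :
  psdmx A -> X *m A = X -> psdmx (A - proj_ortho X).
Proof.
move=> pA XA; pose B := 1%:M - proj_ortho X.
have QA : proj_ortho X *m A = proj_ortho X.
  apply/eqP; rewrite -subr_eq0 -{2}[proj_ortho X]mulmx1 -mulmxBr; apply/eqP.
  by apply/mul_proj_ortho_eq0; rewrite mulmxBr XA mulmx1 subrr.
have hB : B^t* = B by rewrite linearB map_mxB /= trmx1 map_mx1 proj_ortho_adj.
have BAE : B *m A = A - proj_ortho X by rewrite mulmxBl mul1mx QA.
have AQ : A *m proj_ortho X = proj_ortho X.
  by rewrite -{1}(psdmx_adj pA) -{1}proj_ortho_adj -adjmxM QA proj_ortho_adj.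
have -> : A - proj_ortho X = B *m A *m B^t*.
  by rewrite hB BAE mulmxBr mulmx1 mulmxBl AQ proj_ortho_proj subrr subr0.
exact: psdmx_conj.
Qed.

(* Shorting [G] to the orthogonal complement of [X]: with [G = T T^*], the
   operator [T Q T^*], where [Q] projects onto the complement of [X T], is the
   Schur complement of the [X]-block of [G]. *)
Lemma psdmx_short n (X G : 'M[C]_n) : psdmx G ->
  exists S : 'M_n, [/\ psdmx S, psdmx (G - S), X *m S = 0 &
    forall m (V : 'M_(m, n)), V *m G *m X^t* = 0 -> V *m S = V *m G].
Proof.
case/psdmx_sqrt=> T eG; pose Q := proj_ortho ((X *m T)^!)%MS.
have pQ : psdmx Q by apply: psdmx_proj_ortho.
have XTQ : X *m T *m Q = 0 by rewrite proj_ortho_0 // ortho_id.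
have QK m (W : 'M_(m, n)) : W *m (X *m T)^t* = 0 -> W *m Q = W.
  by move=> /orthomx1P/proj_ortho_id.
have GS : G - T *m Q *m T^t* = T *m proj_ortho (X *m T) *m T^t*.
  rewrite eG -{1}[T]mulmx1 -(proj_ortho_add_compl (X *m T)).
  by rewrite mulmxDr mulmxDl addrK.
clearbody Q; exists (T *m Q *m T^t*); split.
- exact: psdmx_conj.
- by rewrite GS; exact/psdmx_conj/psdmx_proj_ortho.
- by rewrite !mulmxA XTQ mul0mx.
(* The hypothesis says that [V *m T] is orthogonal to [X *m T], so [Q] fixes it. *)
by move=> m V; rewrite eG !mulmxA => VX; rewrite QK // adjmxM mulmxA.
Qed.

End PositiveMatrices.

(** * Comparison of the full problem with the reduced one *)

Section Reduction.
Variables (C : numClosedFieldType) (n M : nat).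
Variables (rho : 'I_M -> 'M[C]_n) (p : 'I_M -> C).
Implicit Types (F G : option 'I_M -> 'M[C]_n) (X : 'M[C]_n).

Lemma usdm1P F : usdm 1%:M rho F <->
  [/\ forall k, psdmx (F k), F None + \sum_j F (Some j) = 1%:M
    & forall j k, j != k -> \tr (rho j *m F (Some k)) = 0].
Proof.
rewrite /usdm /povm proj_ortho1 big_option; split=> [[[pF sF] tF]|[pF sF tF]].
  by split=> // k; case: (pF k).
by split=> //; split=> // k; split=> //; apply: operator_on1.
Qed.

(** Under the trace, [A] absorbs both projections; only the normalisation remains. *)
Lemma mxtrace_reduced_state X A j : psdmx A -> X *m A = 0 ->
  \tr (reduced_state X rho j *m A) = (reduced_weight X rho j)^-1 * \tr (rho j *m A).
Proof.
move=> pA /mul_proj_ortho_eq0 QA; rewrite -scalemxAl mxtraceZ; congr (_ * _).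
have PA : proj_ortho (X^!)%MS *m A = A.
  by rewrite -[RHS]mul1mx -(proj_ortho_add_compl X) mulmxDl QA add0r.
have AP : A *m proj_ortho (X^!)%MS = A.
  by rewrite -{1}(psdmx_adj pA) -proj_ortho_adj -adjmxM PA (psdmx_adj pA).
by rewrite -[_ *m A]mulmxA PA mxtrace_mulC mulmxA AP mxtrace_mulC.
Qed.

Lemma usdm_reducedP X F : (forall j, 0 < reduced_weight X rho j) ->
  usdm (X^!)%MS (reduced_state X rho) F <->
  [/\ forall k, psdmx (F k), forall k, X *m F k = 0,
    F None + \sum_j F (Some j) = 1%:M - proj_ortho X
    & forall j k, j != k -> \tr (rho j *m F (Some k)) = 0].
Proof.
move=> N_gt0; rewrite /usdm /povm big_option.
have -> : proj_ortho (X^!)%MS = 1%:M - proj_ortho X.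
  by rewrite -(proj_ortho_add_compl X) addrC addKr.
split=> [[[oF sF] tF]|[pF XF sF tF]].
  have pF k : psdmx (F k) by case: (oF k).
  have XF k : X *m F k = 0.
    by have [/(operator_on_orthoP _ (psdmx_adj (pF k)))] := oF k.
  split=> // j k jk; have /eqP := tF j k jk.
  by rewrite mxtrace_reduced_state // mulf_eq0 invr_eq0 gt_eqF //= => /eqP.
split=> [|j k jk]; last by rewrite mxtrace_reduced_state // tF // mulr0.
split=> // k; split=> //.
by apply/(operator_on_orthoP _ (psdmx_adj (pF k))).
Qed.

(** The weight in each reduced prior cancels the normalisation of the reduced state, leaving a
    factor common to all outcomes. *)
Lemma failure_reduced X F : (forall j, 0 < reduced_weight X rho j) ->
  psdmx (F None) -> X *m F None = 0 ->
  failure (reduced_state X rho) (reduced_prior X rho p) F =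
  (\sum_k reduced_weight X rho k * p k)^-1 * failure rho p F.
Proof.
move=> N_gt0 pF XF; rewrite /failure mulr_sumr; apply: eq_bigr => j _.
rewrite mxtrace_reduced_state // /reduced_prior.
rewrite mulrAC mulrC; congr (_ * _).
rewrite mulrA [_ * p j]mulrC mulfK //.
by rewrite gt_eqF.
Qed.

(** All reduced failure probabilities are rescaled by one positive factor, so optimality can be
    tested with the original states and priors. *)
Lemma reduced_optimalP X F (i : 'I_M) :
  (forall j, 0 < p j) -> (forall j, 0 < reduced_weight X rho j) ->
  reduced_optimal_usdm X rho p F <->
  usdm (X^!)%MS (reduced_state X rho) F /\
  forall G, usdm (X^!)%MS (reduced_state X rho) G ->
    failure rho p F <= failure rho p G.
Proof.
move=> p_gt0 N_gt0.
(* The index [i] keeps the sum from being empty. *)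
have w_gt0 : 0 < (\sum_k reduced_weight X rho k * p k)^-1.
  rewrite invr_gt0 (bigD1 i) //= ltr_pwDl ?mulr_gt0 //.
  by apply: sumr_ge0 => j _; rewrite ltW ?mulr_gt0.
have leE G H : usdm (X^!)%MS (reduced_state X rho) G ->
    usdm (X^!)%MS (reduced_state X rho) H ->
    (failure (reduced_state X rho) (reduced_prior X rho p) G <=
     failure (reduced_state X rho) (reduced_prior X rho p) H) =
    (failure rho p G <= failure rho p H).
  move=> /(usdm_reducedP _ N_gt0)[pG XG _ _] /(usdm_reducedP _ N_gt0)[pH XH _ _].
  by rewrite !failure_reduced // ler_pM2l.
split=> -[uF oF]; split=> // G uG; first by rewrite -leE // oF.
by rewrite leE // oF.
Qed.

(** * Splitting off the projection onto a common subspace *)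

Lemma failure_add X F F' : F None = F' None + proj_ortho X ->
  failure rho p F = failure rho p F' + \sum_j p j * \tr (rho j *m proj_ortho X).
Proof.
move=> FE; rewrite /failure -big_split; apply: eq_bigr => j _.
by rewrite FE mulmxDr mxtraceD mulrDr.
Qed.

Lemma usdm_add_proj X F F' : (forall j, 0 < reduced_weight X rho j) ->
  (forall j, F (Some j) = F' (Some j)) -> F None = F' None + proj_ortho X ->
  usdm (X^!)%MS (reduced_state X rho) F' -> usdm 1%:M rho F.
Proof.
move=> N_gt0 FS FN /(usdm_reducedP _ N_gt0)[pF XF sF tF].
apply/usdm1P; split=> [[j|]||j k jk].
- by rewrite FS.
- by rewrite FN; apply: psdmxD => //; apply: psdmx_proj_ortho.
- by rewrite FN addrAC (eq_bigr _ (fun j _ => FS j)) sF subrK.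
- by rewrite FS tF.
Qed.

Lemma usdm_sub_proj X F F' : (forall j, 0 < reduced_weight X rho j) ->
  (forall j, X *m F (Some j) = 0) ->
  (forall j, F' (Some j) = F (Some j)) -> F' None = F None - proj_ortho X ->
  usdm 1%:M rho F -> usdm (X^!)%MS (reduced_state X rho) F'.
Proof.
move=> N_gt0 XF FS FN /usdm1P[pF sF tF].
(* The conclusive operators vanish on [X], so completeness makes the inconclusive one the identity
   there. *)
have XN : X *m F None = X.
  by rewrite -[RHS]mulmx1 -sF mulmxDr mulmx_sumr big1 ?addr0 //.
apply/(usdm_reducedP _ N_gt0); split=> [[j|]|[j|]||j k jk].
- by rewrite FS.
- by rewrite FN; apply: psdmx_sub_proj.
- by rewrite FS.
- by rewrite FN mulmx_sub_proj.
- by rewrite FN addrAC (eq_bigr _ (fun j _ => FS j)) sF.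
- by rewrite FS tF.
Qed.

(** Adding or removing [proj_ortho X] matches the USDMs of both problems and shifts every failure
    probability by the same constant, so minimisers correspond. *)
Lemma optimal_usdm_split X F (i : 'I_M) :
  (forall j, 0 < p j) -> (forall j, 0 < reduced_weight X rho j) ->
  (forall G, usdm 1%:M rho G -> forall j, X *m G (Some j) = 0) ->
  optimal_usdm 1%:M rho p F <->
  exists F', [/\ reduced_optimal_usdm X rho p F',
    forall j, F (Some j) = F' (Some j) & F None = F' None + proj_ortho X].
Proof.
move=> p_gt0 N_gt0 X0; have redP := reduced_optimalP _ i p_gt0 N_gt0.
split=> [[uF oF]|[F' [/redP[uF' oF'] FS FN]]].
  pose F' k := if k is Some j then F (Some j) else F None - proj_ortho X.
  have FN : F None = F' None + proj_ortho X by rewrite subrK.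
  exists F'; split=> //; apply/redP.
  split=> [|G' uG']; first by apply: (usdm_sub_proj N_gt0 (X0 _ uF)) uF.
  pose G k := if k is Some j then G' (Some j) else G' None + proj_ortho X.
  rewrite -(lerD2r (\sum_j p j * \tr (rho j *m proj_ortho X))).
  rewrite -(failure_add FN) -(failure_add (erefl : G None = _)).
  by apply: oF; apply: (usdm_add_proj N_gt0 _ _ uG').
split=> [|G uG]; first by apply: (usdm_add_proj N_gt0 _ _ uF').
pose G' k := if k is Some j then G (Some j) else G None - proj_ortho X.
have GN : G None = G' None + proj_ortho X by rewrite subrK.
rewrite (failure_add FN) (failure_add GN) lerD2r; apply: oF'.
by apply: (usdm_sub_proj N_gt0 (X0 _ uG)) uG.
Qed.

(** * Vanishing products and elimination of an orthogonal subspace *)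

Lemma usdm_mul0 F j k : (forall j, psdmx (rho j)) -> usdm 1%:M rho F ->
  j != k -> rho j *m F (Some k) = 0.
Proof.
by move=> prho /usdm1P[pF _ tF] jk; apply: mxtrace_psdmxM_eq0 => //; apply: tF.
Qed.

(* The inconclusive operator of [G] is replaced by its shorted operator [S], and
   [F' (Some i)] is [G (Some i) + (G None - S)] with the identity on [X]
   removed. *)
Lemma usdm_eliminate X G i : (forall j, psdmx (rho j)) -> (forall j, 0 < p j) ->
  (forall j, 0 < reduced_weight X rho j) ->
  (X <= rho i)%MS -> (forall j, j != i -> X *m rho j = 0) ->
  usdm 1%:M rho G ->
  exists2 F', usdm (X^!)%MS (reduced_state X rho) F' &
    failure rho p F' <= failure rho p G.
Proof.
move=> prho p_gt0 N_gt0 Xi Xj uG; have rG := usdm_mul0 prho uG.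
have /usdm1P[pG sG tG] := uG.
have XG k : k != i -> X *m G (Some k) = 0.
  move=> ki; have /submxP[W ->] := Xi.
  by rewrite -mulmxA rG ?mulmx0 // eq_sym.
have GX k : k != i -> G (Some k) *m X^t* = 0.
  by move=> ki; rewrite -(psdmx_adj (pG _)) -adjmxM XG // trmx0 map_mx0.
have rX j : j != i -> rho j *m X^t* = 0.
  by move=> ji; rewrite -(psdmx_adj (prho _)) -adjmxM Xj // trmx0 map_mx0.
have GN : G None = 1%:M - \sum_k G (Some k) by rewrite -sG addrK.
have [S [pS pGS XS SG]] := psdmx_short X (pG None).
(* In [G None = 1 - \sum_k G (Some k)], the terms 1 and [k != i] vanish against [X^t*], the first
   after multiplication by [rho j], while [rho j] kills [G (Some i)]. *)
have rS j : j != i -> rho j *m S = rho j *m G None.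
  move=> ji; apply: SG; rewrite GN mulmxBr mulmx1 mulmxBl rX // sub0r.
  rewrite mulmx_sumr mulmx_suml big1 ?oppr0 // => k _.
  have [->|ki] := eqVneq k i; first by rewrite rG // mul0mx.
  by rewrite -mulmxA GX // mulmx0.
pose A := G (Some i) + (G None - S).
have pA : psdmx A by apply: psdmxD.
(* [S] kills [X], and [G (Some i) + G None] differs from the identity only by operators that kill
   [X]. *)
have XA : X *m A = X.
  have GiN : G (Some i) + G None = 1%:M - \sum_(k | k != i) G (Some k).
    by rewrite -sG (bigD1 i) //= addrA addrK addrC.
  rewrite /A mulmxDr mulmxBr XS subr0 -mulmxDr GiN.
  by rewrite mulmxBr mulmx1 mulmx_sumr big1 ?subr0 // => k /XG.
pose F' k := if k is Some j then if j == i then A - proj_ortho X else G (Some j)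
  else S.
have rQ j : j != i -> rho j *m proj_ortho X = 0.
  by move/Xj; apply: psdmx_mul_proj_ortho0.
exists F'; last first.
  apply: ler_sum => j _; rewrite ler_pM2l // -subr_ge0 -linearB -mulmxBr.
  exact: mxtrace_psdmxM_ge0.
apply/(usdm_reducedP _ N_gt0); split=> [[j|]|[j|]||j k jk] //=.
- by case: eqP => _ //; apply: psdmx_sub_proj.
- by case: eqVneq => [_|/XG//]; apply: mulmx_sub_proj.
- rewrite -sG [in RHS](bigD1 i) //= (bigD1 i) //= eqxx.
  rewrite (eq_bigr (fun j => G (Some j))) => [|j /negPf-> //].
  rewrite [_ - _ + _]addrAC addrA; congr (_ - _).
  by rewrite !addrA -[S + _ + _]addrA [S + _]addrC addrK [G None + _]addrC.
(* For [k = i], [rho j] kills both corrections, [proj_ortho X] and [G None - S]. *)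
- have [ki|_] := eqVneq k i; last exact: tG.
  rewrite ki in jk; rewrite mulmxBr rQ // subr0 mulmxDr mulmxBr rS // subrr addr0.
  exact: tG.
Qed.

(** [F] and [F'] fail equally often, and every USDM of the full problem is matched or beaten by a
    reduced one, hence by [F']. *)
Lemma optimal_usdm_eliminate X F F' i :
  (forall j, psdmx (rho j)) -> (forall j, 0 < p j) ->
  (forall j, 0 < reduced_weight X rho j) ->
  (X <= rho i)%MS -> (forall j, j != i -> X *m rho j = 0) ->
  reduced_optimal_usdm X rho p F' ->
  F (Some i) = F' (Some i) + proj_ortho X ->
  (forall j, j != i -> F (Some j) = F' (Some j)) ->
  F None = F' None ->
  optimal_usdm 1%:M rho p F.
Proof.
move=> prho p_gt0 N_gt0 Xi Xj /(reduced_optimalP _ i p_gt0 N_gt0)[uF' oF'].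
move=> Fi Fj FN.
split=> [|G uG]; last first.
  have [G' uG' le_G'G] := usdm_eliminate prho p_gt0 N_gt0 Xi Xj uG.
  by rewrite {1}/failure FN; apply: le_trans (oF' _ uG') le_G'G.
have /(usdm_reducedP _ N_gt0)[pF' XF' sF' tF'] := uF'.
apply/usdm1P; split=> [[j|]||j k jk].
- have [->|/Fj->//] := eqVneq j i.
  by rewrite Fi; apply: psdmxD => //; apply: psdmx_proj_ortho.
- by rewrite FN.
- rewrite FN (bigD1 i) //= Fi (eq_bigr _ Fj) addrAC addrA.
  by rewrite -(bigD1 i (P := predT)) //= sF' subrK.
- have [ki|/Fj->] := eqVneq k i; last exact: tF'.
  rewrite ki in jk *; rewrite Fi mulmxDr mxtraceD tF' // add0r.
  by rewrite (psdmx_mul_proj_ortho0 (prho j) (Xj j jk)) mxtrace0.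
Qed.

End Reduction.

(** * Both reductions, applied to the supports of [rho i] and of the rest *)

Theorem mainTheorem4 (R : realType) (n M : nat)
    (rho : 'I_M -> 'M[R[i]]_n) (p : 'I_M -> R[i]) (i : 'I_M) :
  (2 <= M)%N ->
  (forall j, density_mx (rho j)) ->
  (forall j, 0 < p j) ->
  \sum_j p j = 1 ->
  (\sum_j support_mx (rho j) :=: 1%:M)%MS ->
  (let X := (support_mx (rho i) :&: support_mx (rest_state rho p i))%MS in
   (forall j, 0 < reduced_weight X rho j) ->
   forall F : option 'I_M -> 'M[R[i]]_n,
     optimal_usdm 1%:M rho p F <->
     exists F' : option 'I_M -> 'M[R[i]]_n,
       [/\ reduced_optimal_usdm X rho p F',
           forall j, F (Some j) = F' (Some j)
         & F None = F' None + proj_ortho X])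
  /\
  (let X := ((support_mx (rest_state rho p i))^! :&: support_mx (rho i))%MS in
   (forall j, 0 < reduced_weight X rho j) ->
   forall F F' : option 'I_M -> 'M[R[i]]_n,
     reduced_optimal_usdm X rho p F' ->
     F (Some i) = F' (Some i) + proj_ortho X ->
     (forall j, j != i -> F (Some j) = F' (Some j)) ->
     F None = F' None ->
     optimal_usdm 1%:M rho p F).
Proof.
move=> M_ge2 drho p_gt0 p_sum _.
have prho j : psdmx (rho j) by case: (drho j).
(* As [M >= 2], some other index carries positive prior. *)
have pi_lt1 : 0 < 1 - p i.
  rewrite -p_sum (bigD1 i) //= addrAC subrr add0r.
  have [k ki] : exists k : 'I_M, k != i.
    move: M_ge2; rewrite -[M in (_ < M)%N]card_ord => /card_gt1P[x [y [_ _ xy]]].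
    have [xi|xi] := eqVneq x i; last by exists x.
    by exists y; rewrite -xi eq_sym.
  rewrite (bigD1 k) //= ltr_pwDl //.
  by apply: sumr_ge0 => j _; apply: ltW.
have prest : psdmx (rest_state rho p i).
  apply: psdmxZ; first by rewrite invr_ge0 ltW.
  by apply: psdmx_sum => j _; apply: psdmxZ => //; apply: ltW.
split=> X N_gt0 F.
  (* [X] lies in both supports: the rest state kills [G (Some i)], and [rho i] kills all other
     conclusive operators. *)
  apply: (optimal_usdm_split F i p_gt0 N_gt0) => G uG j.
  have [->|ji] := eqVneq j i.
    have /submxP[W ->] : (X <= rest_state rho p i)%MS.
      by rewrite -(psdmx_support prest) capmxSr.
    rewrite -mulmxA -scalemxAl mulmx_suml big1 ?scaler0 ?mulmx0 // => k ki.
    by rewrite -scalemxAl (usdm_mul0 prho uG) // scaler0.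
  have /submxP[W ->] : (X <= rho i)%MS by rewrite -(psdmx_support (prho i)) capmxSl.
  by rewrite -mulmxA (usdm_mul0 prho uG) ?mulmx0 // eq_sym.
move=> F'; apply: (optimal_usdm_eliminate prho p_gt0 N_gt0).
  by rewrite -(psdmx_support (prho i)) capmxSr.
(* The rest state is a positive combination of positive matrices, so its product with [X] vanishes
   only if each term's does. *)
have /eqP : X *m rest_state rho p i = 0.
  have : (X <= (rest_state rho p i)^!)%MS.
    by rewrite -(eqmx_ortho _ (psdmx_support prest)) capmxSl.
  by move/orthomx1P; rewrite psdmx_adj.
rewrite -scalemxAr scaler_eq0 invr_eq0 gt_eqF //= => /eqP Xrest j ji.
have pk k : k != i -> psdmx (p k *: rho k) by move=> _; apply/psdmxZ/prho/ltW.
have /eqP := psdmx_sum_mul0 pk Xrest ji.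
by rewrite -scalemxAr scaler_eq0 gt_eqF // => /eqP.
Qed.
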